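(* Let $\lambda_*>0$, $\kappa_*>0$, $\sigma_*^2\ge 0$, let $\Pi$ be a probability law on $\mathbb R$ with finite second moment $r_*^2=\mathbb E_{\beta\sim\Pi}[\beta^2]$, let $\beta\sim\Pi$ and let $Z\sim\mathcal N(0,1)$ be independent of $\beta$. Let $\tilde f(x)=|x|$. Consider the following two systems of equations. (AMP) In the unknowns $(\tau_1,\gamma_1)$, with $\tau_1>0$ and $\lambda_*+\gamma_1>0$: $$\tau_1^2=\sigma_*^2+\kappa_*\,\mathbb E\big[(\eta(\beta+\tau_1 Z;\lambda_*+\gamma_1)-\beta)^2\big],\qquad \gamma_1=\kappa_*(\gamma_1+\lambda_* )\,\mathbb E\big[\eta'(\beta+\tau_1 Z;\lambda_*+\gamma_1)\big].$$ (CGMT) In the unknowns $(\alpha,\sigma,\tau_2,\theta,\lambda,\gamma_2)$, with $\alpha,\theta\in\mathbb R$, $\sigma,\tau_2,\gamma_2>0$, $\lambda\ge0$: $$0=-\frac{\alpha}{\sigma\tau_2}+\theta-1+\frac{\alpha+\lambda}{\lambda+1},$$ $$0=-\frac{1}{2\tau_2}+\frac{r_*^2\kappa_*\alpha^2}{2\sigma^2\tau_2}-\frac{\tau_2\kappa_*}{2}\mathbb E\big[(\mathrm{Prox}_{\tilde f}(\gamma_2Z+\theta\beta;\lambda_* ))^2\big]+\frac{\sigma}{\lambda+1},$$ $$0=\gamma_2^2-r_*^2\kappa_*-\sigma_*^2+\frac{2[(\alpha+\lambda)r_*^2\kappa_*+\lambda\sigma_*^2]}{\lambda+1}-\frac{(\alpha+\lambda)^2r_*^2\kappa_*+\sigma^2+\lambda^2\sigma_*^2}{(\lambda+1)^2},$$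 $$0=r_*^2\kappa_*\alpha-\sigma\tau_2\kappa_*\,\mathbb E\big[\beta\,\mathrm{Prox}_{\tilde f}(\gamma_2Z+\theta\beta;\lambda_* )\big],$$ $$\lambda=\sigma\tau_2\kappa_*\,\mathbb E\Big[\frac{\partial \mathrm{Prox}_{\tilde f}}{\partial x}(\gamma_2Z+\theta\beta;\lambda_* )\Big],$$ $$0=\frac{\sigma}{2\tau_2^2}+\frac{r_*^2\kappa_*\alpha^2}{2\sigma\tau_2^2}-\frac{\sigma\kappa_*}{2}\mathbb E\big[(\mathrm{Prox}_{\tilde f}(\gamma_2Z+\theta\beta;\lambda_* ))^2\big].$$ Then the two systems are equivalent: (CGMT) is converted into (AMP) by the parameter transformation $$\tau_1=\frac{\gamma_2}{\theta},\qquad \gamma_1=\frac{\lambda_*}{\theta}-\lambda_*.$$ That is, if $(\alpha,\sigma,\tau_2,\theta,\lambda,\gamma_2)$ solves (CGMT), then $(\tau_1,\gamma_1)$ given by these formulas solves (AMP); and every solution $(\tau_1,\gamma_1)$ of (AMP) arises in this way from some solution of (CGMT).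
   Context: For a convex function $f:\mathbb R\to\mathbb R$, $x\in\mathbb R$, $t>0$, the proximal operator is $\mathrm{Prox}_f(x;t)=\arg\min_{z\in\mathbb R}\{f(z)+\frac{1}{2t}(x-z)^2\}$, and $\frac{\partial}{\partial x}$ is the derivative with respect to the first argument (existing almost everywhere). The soft-threshold function is $\eta(x;t)=\mathrm{sign}(x)\,(|x|-t)_+$ with $u_+=\max\{u,0\}$ and $\mathrm{sign}(x)=1,0,-1$ for $x>0$, $x=0$, $x<0$; $\eta'(x;t)$ is its derivative in $x$ (almost everywhere defined). The two systems are the ''state equations'' obtained by approximate message passing (AMP) and by the convex Gaussian min-max theorem (CGMT) for the LASSO problem $\min_{\boldsymbol\beta}\frac12\|\mathbf y-\mathbf X\boldsymbol\beta\|_2^2+\lambda_*\|\boldsymbol\beta\|_1$ in the linear model $y_i=\mathbf x_i^T\boldsymbol\beta^*+\epsilon_i$, with $\mathbf x_i$ i.i.d. $\mathcal N(0,\frac1n I_d)$, noise of mean $0$ and variance $\sigma_*^2$, entries of $\boldsymbol\beta^*$ distributed as $\Pi$, and $d/n\to\kappa_*$. *)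

(* Defs.v *)
From HB Require Import structures.
From mathcomp Require Import all_boot all_order all_algebra.
From mathcomp Require Import all_classical all_reals all_analysis.

Set Implicit Arguments.
Unset Strict Implicit.
Unset Printing Implicit Defensive.

Import Order.TTheory GRing.Theory Num.Theory.
Import numFieldNormedType.Exports.

Local Open Scope classical_set_scope.
Local Open Scope ring_scope.

Definition prox_argmin (R : realType) (f : R -> R) (x t : R) : set R :=
  [set z | forall z' : R,
     f z + (2 * t)^-1 * (x - z) ^+ 2 <= f z' + (2 * t)^-1 * (x - z') ^+ 2].

(* For f convex and t > 0 the set of minimizers is a singleton, so that [get]
   returns its element. *)
Definition prox (R : realType) (f : R -> R) (x t : R) : R :=
  get (prox_argmin f x t).

(* [derive1] is total; at the points where the derivative does not exist its
   value is irrelevant. The same holds for [deta] below: these functions are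
   only evaluated at random points having a density. *)
Definition dprox (R : realType) (f : R -> R) (x t : R) : R :=
  derive1 (fun u : R => prox f u t) x.

Definition eta (R : realType) (x t : R) : R :=
  Num.sg x * Num.max (`|x| - t) 0.

Definition deta (R : realType) (x t : R) : R :=
  derive1 (fun u : R => eta u t) x.

Section RandomVariables.
Context d (T : measurableType d) (R : realType) (P : probability T R).

(* Equality is required on measurable sets only: a library measure is a
   function on all sets, with no constraint on non-measurable ones. *)
Definition has_law (X : {RV P >-> R}) (mu : set (measurableTypeR R) -> \bar R) :=
  forall A : set (measurableTypeR R), measurable A -> distribution P X A = mu A.

Definition independent_RV (X Y : {RV P >-> R}) :=
  forall A B : set (measurableTypeR R), measurable A -> measurable B ->
    P (X @^-1` A `&` Y @^-1` B) = (P (X @^-1` A) * P (Y @^-1` B))%E.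

(* Real-valued expectation. When beta is square-integrable and Z is Gaussian,
   all the variables it is applied to below are integrable, so that [fine] never
   meets an infinite value. *)
Definition Exp (X : T -> R) : R := fine ('E_P[X])%E.

(* lambdas, kappas, sigmas2, rs2 stand for the constants written
   lambda_*, kappa_*, sigma_*^2, r_*^2. *)
Record AMP (beta Z : T -> R) (lambdas kappas sigmas2 : R)
    (tau1 gamma1 : R) : Prop := {
  AMP_tau1_gt0 : 0 < tau1;
  AMP_threshold_gt0 : 0 < lambdas + gamma1;
  AMP_eq1 : tau1 ^+ 2 = sigmas2 +
    kappas * Exp (fun w =>
      (eta (beta w + tau1 * Z w) (lambdas + gamma1) - beta w) ^+ 2);
  AMP_eq2 : gamma1 = kappas * (gamma1 + lambdas) *
    Exp (fun w => deta (beta w + tau1 * Z w) (lambdas + gamma1)) }.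

Record CGMT (beta Z : T -> R) (lambdas kappas sigmas2 rs2 : R)
    (alpha sigma tau2 theta lambda gamma2 : R) : Prop := {
  CGMT_sigma_gt0 : 0 < sigma;
  CGMT_tau2_gt0 : 0 < tau2;
  CGMT_gamma2_gt0 : 0 < gamma2;
  CGMT_lambda_ge0 : 0 <= lambda;
  CGMT_eq1 : 0 = - (alpha / (sigma * tau2)) + theta - 1
    + (alpha + lambda) / (lambda + 1);
  CGMT_eq2 : 0 = - (1 / (2 * tau2))
    + rs2 * kappas * alpha ^+ 2 / (2 * sigma ^+ 2 * tau2)
    - tau2 * kappas / 2 * Exp (fun w =>
        prox (fun x : R => `|x|) (gamma2 * Z w + theta * beta w) lambdas ^+ 2)
    + sigma / (lambda + 1);
  CGMT_eq3 : 0 = gamma2 ^+ 2 - rs2 * kappas - sigmas2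
    + 2 * ((alpha + lambda) * rs2 * kappas + lambda * sigmas2) / (lambda + 1)
    - ((alpha + lambda) ^+ 2 * rs2 * kappas + sigma ^+ 2
       + lambda ^+ 2 * sigmas2) / (lambda + 1) ^+ 2;
  CGMT_eq4 : 0 = rs2 * kappas * alpha
    - sigma * tau2 * kappas * Exp (fun w =>
        beta w *
        prox (fun x : R => `|x|) (gamma2 * Z w + theta * beta w) lambdas);
  CGMT_eq5 : lambda = sigma * tau2 * kappas * Exp (fun w =>
        dprox (fun x : R => `|x|) (gamma2 * Z w + theta * beta w) lambdas);
  CGMT_eq6 : 0 = sigma / (2 * tau2 ^+ 2)
    + rs2 * kappas * alpha ^+ 2 / (2 * sigma * tau2 ^+ 2)
    - sigma * kappas / 2 * Exp (fun w =>
        prox (fun x : R => `|x|) (gamma2 * Z w + theta * beta w) lambdas ^+ 2) }.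

End RandomVariables.

(* Main.v *)
Require Import Defs.
From HB Require Import structures.
From mathcomp Require Import all_boot all_order all_algebra.
From mathcomp Require Import all_classical all_reals all_analysis.
From mathcomp Require Import measurable_realfun ring lra.

Set Implicit Arguments.
Unset Strict Implicit.
Unset Printing Implicit Defensive.

Import Order.TTheory GRing.Theory Num.Theory.
Import numFieldNormedType.Exports.

Local Open Scope classical_set_scope.
Local Open Scope ring_scope.

(** Everything rests on two observations.

    The proximal operator of the absolute value is the soft threshold [eta]
    ([prox_normr]), and soft thresholding is homogeneous: [eta] satisfies
    eta(cx; ct) = c eta(x; t) for c > 0 ([etaZ]), hence its derivative is
    invariant under the same scaling ([detaZ]). So with tau_1 = gamma_2 / theta
    and t = lambda_* / theta, every expectation in the CGMT system is a power of
    theta times an expectation of the AMP estimate s = eta(beta + tau_1 Z; t)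
    ([Exp_sqr_prox], [Exp_beta_prox], [Exp_dprox]).

    In the CGMT system, tau_2 and theta can be eliminated without looking at the
    expectations. The sixth equation divided by sigma / tau_2, subtracted from
    the second, gives sigma tau_2 = lambda + 1, and then the first gives
    theta = 1 / (lambda + 1); see [CGMT_sigma_tau2_theta]. In particular
    theta > 0, so the rescaling applies. What is left is
      r_*^2 alpha = E[beta s],
      sigma^2 + kappa_* r_*^2 alpha^2 = kappa_* E[s^2],
      tau_1^2 = sigma_*^2 + kappa_* r_*^2 (1 - alpha)^2 + sigma^2,
    and the equation for lambda. The first two turn the third into the first AMP
    equation, because E[(s - beta)^2] = E[s^2] - 2 E[beta s] + r_*^2; the
    equation for lambda is the second AMP equation, since
    gamma_1 = lambda_* lambda.

    Conversely, a solution of AMP prescribes theta = lambda_* / (lambda_* +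
    gamma_1), lambda = 1 / theta - 1 and gamma_2 = theta tau_1, and lambda >= 0
    because [eta] is nondecreasing. One still needs alpha solving the first
    displayed equation and sigma > 0 solving the second, that is,
    E[s^2] > r_*^2 alpha^2: a strict Cauchy-Schwarz inequality between s and
    beta. It says that s is not almost surely equal to a multiple a beta of
    beta, and this is where the Gaussian law and independence enter: with
    positive probability beta stays bounded while Z exceeds any given level,
    which makes s larger than a beta ([eta_not_proportional]). Strictness is
    used as E[(s - a beta)^2] > 0 for every a, a form that also covers
    r_*^2 = 0 ([positive_form_solution]). *)

Local Notation eta := Defs.eta.

(** * The soft threshold *)

Lemma eta_gt (R : realType) (x t : R) : 0 <= t -> t < x -> eta x t = x - t.
Proof.
move=> t0 tx; have x0 : 0 < x by exact: le_lt_trans tx.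
by rewrite /eta gtr0_sg// mul1r gtr0_norm// max_l// subr_ge0 ltW.
Qed.

Lemma eta_lt (R : realType) (x t : R) : 0 <= t -> x < - t -> eta x t = x + t.
Proof.
move=> t0 xt; have x0 : x < 0 by lra.
rewrite /eta ltr0_sg// ltr0_norm// max_l; first by lra.
by lra.
Qed.

Lemma eta_mid (R : realType) (x t : R) : `|x| <= t -> eta x t = 0.
Proof. by move=> xt; rewrite /eta max_r ?mulr0// subr_le0. Qed.

(** From this difference of a nondecreasing and a nonincreasing function, both
    measurable, one reads off that [eta] is nondecreasing and measurable. *)
Lemma etaE (R : realType) (x t : R) : 0 <= t ->
  eta x t = Num.max (x - t) 0 - Num.max (- x - t) 0.
Proof.
move=> t0; have [xt|xt] := lerP `|x| t.
  by move: (xt); rewrite ler_norml => /andP[? ?]; rewrite eta_mid// !max_r; lra.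
have [x0|x0] := lerP 0 x.
- rewrite ger0_norm// in xt; rewrite eta_gt//.
  by rewrite (@max_l _ _ (x - t)) ?(@max_r _ _ (- x - t)) ?subr0//; lra.
- rewrite ltr0_norm// in xt; rewrite eta_lt//; last by lra.
  by rewrite (@max_r _ _ (x - t)) ?(@max_l _ _ (- x - t))//; lra.
Qed.

Lemma eta_nondecreasing (R : realType) (t : R) : 0 <= t ->
  {homo (fun x : R => eta x t) : x y / x <= y}.
Proof.
move=> t0 x y xy; rewrite !etaE// lerB//.
- by rewrite ge_max !le_max lexx lerB// orbT.
- by rewrite ge_max !le_max lexx lerB// ?lerN2// orbT.
Qed.

Lemma norm_eta_le (R : realType) (x t : R) : 0 <= t -> `|eta x t| <= `|x|.
Proof.
move=> t0; rewrite /eta normrM; have [->|x0] := eqVneq x 0.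
  by rewrite sgr0 normr0 mul0r.
rewrite normr_sg x0 mul1r ger0_norm ?le_max ?lexx ?orbT//.
by rewrite ge_max normr_ge0 andbT gerBl.
Qed.

Lemma etaZ (R : realType) (c x t : R) : 0 < c -> eta (c * x) (c * t) = c * eta x t.
Proof.
move=> c0; rewrite /eta sgrM gtr0_sg// mul1r normrM gtr0_norm// -mulrBr.
by rewrite -{1}(mulr0 c) -maxr_pMr ?(ltW c0)// mulrCA.
Qed.

Lemma measurable_eta (R : realType) (t : R) : 0 <= t ->
  measurable_fun [set: R] (fun x => eta x t).
Proof.
move=> t0; under eq_fun do rewrite etaE//.
by apply: measurable_funB; apply: measurable_maxr => //; apply: measurable_funB.
Qed.

(** At z0 = eta(x; t) the slope p = (x - z0) / t is a subgradient of the absolute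
    value: |p| <= 1 and p z0 = |z0|. Hence |z| - |z0| >= p (z - z0), and completing
    the square shows that the objective at z exceeds the one at z0 by at least
    (z - z0)^2 / (2t), so z0 is the only minimizer. *)
Lemma prox_normr (R : realType) (x t : R) : 0 < t ->
  prox (fun u : R => `|u|) x t = eta x t.
Proof.
move=> t0; set z0 := eta x t.
have [p1 pz] : `|(x - z0) / t| <= 1 /\ (x - z0) / t * z0 = `|z0|.
  rewrite normrM normfV (gtr0_norm t0) ler_pdivrMr// mul1r /z0.
  have t0' := ltW t0.
  have [xt|xt] := lerP `|x| t; first by rewrite eta_mid// subr0 mulr0 normr0.
  have [x0|x0] := lerP 0 x.
  - rewrite ger0_norm// in xt; rewrite eta_gt// opprB addrCA subrr addr0.
    by rewrite divff ?gt_eqF// mul1r !gtr0_norm// subr_gt0.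
  - rewrite ltr0_norm// in xt; have xt' : x < - t by lra.
    rewrite eta_lt//; have -> : x - (x + t) = - t by lra.
    by rewrite normrN gtr0_norm// mulNr divff ?gt_eqF// ltr0_norm; lra.
have key z : `|z0| + (2 * t)^-1 * (x - z0) ^+ 2 + (2 * t)^-1 * (z - z0) ^+ 2
    <= `|z| + (2 * t)^-1 * (x - z) ^+ 2.
  have pzz : (x - z0) / t * z <= `|z|.
    by rewrite (le_trans (ler_norm _))// normrM ler_piMl.
  have -> : (2 * t)^-1 * (x - z) ^+ 2 = (2 * t)^-1 * (x - z0) ^+ 2
    + (2 * t)^-1 * (z - z0) ^+ 2 - (x - z0) / t * z + (x - z0) / t * z0.
    by field; rewrite gt_eqF.
  by rewrite pz; lra.
have tt : 0 < (2 * t)^-1 by rewrite invr_gt0 mulr_gt0.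
apply: get_unique => [z|z /(_ z0) zmin].
  by apply: le_trans (key z); rewrite lerDl mulr_ge0 ?sqr_ge0// ltW.
have := le_trans (key z) zmin; rewrite gerDl pmulr_rle0// => z2.
by apply/eqP; rewrite -subr_eq0 -sqrf_eq0 eq_le z2 sqr_ge0.
Qed.

(** Used to change variables in the difference quotients that define [deta]. *)
Lemma dnbhs0Z (R : realType) (c : R) : 0 < c ->
  c * h @[h --> 0^'] = 0^' :> set_system R.
Proof.
have sub (k : R) : 0 < k -> k * h @[h --> 0^'] --> 0^'.
  move=> k0 A /=; rewrite /dnbhs /within /= => /nbhs_ballP[e /= e0 eA].
  apply/nbhs_ballP; exists (e / k) => /=; first by rewrite divr_gt0.
  move=> h; rewrite /ball/= !sub0r normrN => he h0; apply: eA.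
    rewrite /ball/= sub0r normrN normrM gtr0_norm// mulrC -ltr_pdivlMr//.
  by rewrite mulf_neq0// gt_eqF.
move=> c0; apply/seteqP; split=> A; last exact: sub.
rewrite /fmap/= => cA; have ci0 : 0 < c^-1 by rewrite invr_gt0.
have := sub _ ci0 _ cA; rewrite /fmap/=; congr dnbhs.
by apply/funext => h/=; rewrite mulVKf ?gt_eqF.
Qed.

(** The difference quotients on the two sides are the same function up to the
    change of variable h |-> ch, so the identity holds at every point, including
    those where [eta] is not differentiable. *)
Lemma detaZ (R : realType) (c x t : R) : 0 < c -> deta (c * x) (c * t) = deta x t.
Proof.
move=> c0; rewrite /deta /derive1 -[in LHS](dnbhs0Z c0) -fmap_comp.
rewrite (_ : _ \o _ = fun h => h^-1 *: (eta (h + x) t - eta x t))//.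
apply/funext => h /=.
rewrite -mulrDr !etaZ// -mulrBr /GRing.scale/= invfM mulrACA.
by rewrite mulVf ?gt_eqF// mul1r.
Qed.

(** The difference quotients of a nondecreasing function are nonnegative; where
    they diverge, [lim] takes the default value 0. *)
Lemma deta_ge0 (R : realType) (x t : R) : 0 <= t -> 0 <= deta x t.
Proof.
move=> t0; rewrite /deta /derive1; set q := (fun h => _).
have [cq|/dvgP ->] := pselect (cvg (q h @[h --> 0^'])); last by [].
apply: limr_ge => //; near=> h; have h0 : h != 0 by near: h; exact: nbhs_dnbhs_neq.
rewrite /q; have [hp|hn] := ltrP 0 h.
- apply: mulr_ge0; first by rewrite invr_ge0 ltW.
  by rewrite subr_ge0 eta_nondecreasing// lerDr ltW.
- apply: mulr_le0; first by rewrite invr_le0.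
  by rewrite subr_le0 eta_nondecreasing// gerDr.
Unshelve. all: by end_near. Qed.

(** * Square-integrable random variables *)

Lemma Exp_ge0 d (T : measurableType d) (R : realType) (P : probability T R)
    (f : T -> R) : (forall w, 0 <= f w) -> 0 <= Exp P f.
Proof. by move=> f0; rewrite /Exp fine_ge0// expectation_ge0. Qed.

Lemma Lfun2_sqr_lty d (T : measurableType d) (R : realType)
    (mu : {measure set T -> \bar R}) (f : T -> R) :
  measurable_fun [set: T] f -> (\int[mu]_x (f x ^+ 2)%:E < +oo)%E ->
  f \in Lfun mu 2%:E.
Proof.
move=> mf f2; rewrite inE; apply/andP; split; rewrite inE//=.
rewrite /finite_norm unlock/= poweR_lty//.
by under eq_integral do rewrite powR_mulrn// real_normK ?num_real//.
Qed.

Section second_moment.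
Context d (T : measurableType d) (R : realType) (P : probability T R).
Implicit Types f g : T -> R.

Lemma Lfun2_dominated f g : measurable_fun [set: T] g ->
  (forall w, `|g w| <= `|f w|) -> f \in Lfun P 2%:E -> g \in Lfun P 2%:E.
Proof.
move=> mg gf f2; apply: Lfun2_sqr_lty => //.
have /integrableP[mf2] := Lfun2_integrable_sqr f2.
apply: le_lt_trans; apply: ge0_le_integral => //.
- by move=> w _; rewrite lee_fin sqr_ge0.
- by apply/measurable_EFinP; exact: measurable_funX.
- exact: measurableT_comp.
- by move=> w _ /=; rewrite lee_fin normrX -real_normK ?num_real// lerXn2r ?nnegrE.
Qed.

Lemma Lfun2_linear f g (a : R) : f \in Lfun P 2%:E -> g \in Lfun P 2%:E ->
  (fun w => a * f w + g w) \in Lfun P 2%:E.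
Proof.
move=> f2 g2; have p1 : (1 <= 2%:E :> \bar R)%E by rewrite lee_fin ler1n.
by have [_] := Lfun_submod_closed P p1; apply.
Qed.

Lemma ExpD f g : f \in Lfun P 1 -> g \in Lfun P 1 ->
  Exp P (f \+ g) = Exp P f + Exp P g.
Proof.
by move=> f1 g1; rewrite /Exp expectationD// fineD// expectation_fin_num.
Qed.

Lemma ExpZ f (a : R) : f \in Lfun P 1 -> Exp P (a \o* f) = a * Exp P f.
Proof.
by move=> f1; rewrite /Exp expectationZl// fineM// expectation_fin_num.
Qed.

Lemma Exp_sqrB f g (a : R) : f \in Lfun P 2%:E -> g \in Lfun P 2%:E ->
  Exp P (fun w => (f w - a * g w) ^+ 2) =
  Exp P (fun w => f w ^+ 2) - 2 * a * Exp P (fun w => g w * f w)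
    + a ^+ 2 * Exp P (fun w => g w ^+ 2).
Proof.
move=> f2 g2.
have ff : (fun w => f w ^+ 2) \in Lfun P 1 by exact: Lfun2_mul_Lfun1.
have gg : (fun w => g w ^+ 2) \in Lfun P 1 by exact: Lfun2_mul_Lfun1.
have gf : (fun w => g w * f w) \in Lfun P 1 by exact: Lfun2_mul_Lfun1.
have Zl (c : R) h : h \in Lfun P 1 -> c \o* h \in Lfun P 1.
  move=> /Lfun1_integrable h1; apply/Lfun1_integrable.
  exact: (integrableZr measurableT c h1).
have Dl h k : h \in Lfun P 1 -> k \in Lfun P 1 -> h \+ k \in Lfun P 1.
  move=> /Lfun1_integrable h1 /Lfun1_integrable k1.
  by apply/Lfun1_integrable; exact: (integrableD measurableT h1 k1).
rewrite -mulNr -mulNr -!ExpZ// -!ExpD ?Dl ?Zl//.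
by congr Exp; apply/funext => w /=; ring.
Qed.

Lemma Exp_sqr_gt0 f (A : set T) : f \in Lfun P 2%:E -> measurable A ->
  (0 < P A)%E -> (forall w, A w -> f w != 0) ->
  0 < Exp P (fun w => f w ^+ 2).
Proof.
move=> f2 mA PA f0; have ff := Lfun2_integrable_sqr f2.
have mf2 := measurable_int P ff.
rewrite lt_neqAle Exp_ge0 ?andbT//; last by move=> w; rewrite sqr_ge0.
apply/eqP => /esym E0; have : (\int[P]_w `|(f w ^+ 2)%:E| = 0)%E.
  under eq_integral do rewrite gee0_abs ?lee_fin ?sqr_ge0//.
  rewrite -[RHS]/(0%:E) -E0 /Exp unlock fineK//.
  exact: integrable_fin_num.
move/(ae_eq_integral_abs P measurableT mf2) => -[N [mN PN sN]].
have AN : A `<=` N.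
  move=> w Aw; apply: sN => /(_ I) /= [] /eqP.
  by rewrite sqrf_eq0; exact/negP/f0.
by move: PA; rewrite (subset_measure0 mA mN AN PN) ltxx.
Qed.

End second_moment.

(** [has_law] compares measures on the Borel sets of [measurableTypeR R], whereas
    [X] takes values in [R] with its default measurable structure; the proof
    integrates against the push-forward by [X] seen as a map into the former. *)
Lemma ge0_integral_law d (T : measurableType d) (R : realType)
    (P : probability T R) (X : {RV P >-> R})
    (mu : probability (measurableTypeR R) R) (f : R -> \bar R) :
  measurable_fun [set: R] f -> (forall x, 0 <= f x)%E -> has_law X mu ->
  (\int[P]_w f (X w) = \int[mu]_x f x)%E.
Proof.
move=> mf f0 hX.
have mX : measurable_fun [set: T] (X : T -> measurableTypeR R).
  by have := measurable_funPT X; exact.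
transitivity (\int[pushforward P (X : T -> measurableTypeR R)]_x f x)%E.
  by rewrite ge0_integral_pushforward.
by apply: eq_measure_integral => A mA _; exact: hX.
Qed.

(** The density is almost everywhere equal to the Radon-Nikodym derivative, as the
    two have the same integral over every measurable set. *)
Lemma ge0_integral_normal_prob (R : realType) (m s : R) (f : R -> \bar R) :
  measurable_fun [set: R] f -> (forall x, 0 <= f x)%E ->
  (\int[normal_prob m s : probability (measurableTypeR R) R]_x f x =
   \int[lebesgue_measure]_x (f x * (normal_pdf m s x)%:E))%E.
Proof.
move=> mf f0; have dom := @normal_prob_dominates R m s.
rewrite -(Radon_Nikodym_SigmaFinite.change_of_variables dom)//.
have mpdf : measurable_fun [set: R] (fun x => (normal_pdf m s x)%:E).
  by apply/measurable_EFinP; exact: measurable_normal_pdf.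
have intRN := Radon_Nikodym_SigmaFinite.f_integrable dom.
have mRN := measurable_int _ intRN.
apply: ae_eq_integral => //; [exact: emeasurable_funM..|].
have := integral_ae_eq measurableT intRN mpdf.
case => [E _ mE|N [mN N0 sN]].
  by rewrite -(Radon_Nikodym_SigmaFinite.f_integral dom).
exists N; split => //; apply: subset_trans sN => x /= + H; apply.
by move=> _; rewrite H.
Qed.

(** Since x^2 / 4 <= exp(x^2 / 4), the function x^2 exp(-x^2 / 2) is at most
    4 exp(-x^2 / 4), a multiple of the normal density of variance 2. *)
Lemma normal_second_moment (R : realType) :
  (\int[normal_prob 0 1 : probability (measurableTypeR R) R]_x (x ^+ 2)%:E < +oo)%E.
Proof.
have s2 : Num.sqrt 2 != 0 :> R by rewrite sqrtr_eq0 -ltNge.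
pose C : R := 4 * (normal_peak 1 / normal_peak (Num.sqrt 2)).
have C0 : 0 <= C by rewrite !mulr_ge0 ?invr_ge0 ?normal_peak_ge0.
rewrite ge0_integral_normal_prob; last 2 first.
- by apply/measurable_EFinP; exact: measurable_funX.
- by move=> x; rewrite lee_fin sqr_ge0.
apply: (@le_lt_trans _ _
  (\int[lebesgue_measure]_x (C%:E * (normal_pdf 0 (Num.sqrt 2) x)%:E)))%E.
  apply: ge0_le_integral => //=.
  - by move=> x _; rewrite lee_fin mulr_ge0 ?sqr_ge0 ?normal_pdf_ge0.
  - apply/measurable_EFinP/measurable_funM; first exact: measurable_funX.
    exact: measurable_normal_pdf.
  - by apply/measurable_EFinP/measurable_funM => //; exact: measurable_normal_pdf.
  move=> x _; rewrite lee_fin !normal_pdfE ?oner_neq0// /normal_fun subr0.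
  rewrite sqr_sqrtr// expr1n [leRHS]mulrA /C -[4 * _ * _]mulrA divfK; last first.
    by rewrite gt_eqF// normal_peak_gt0.
  rewrite [leLHS]mulrCA -[leRHS]mulrA [leRHS]mulrCA ler_wpM2l ?normal_peak_ge0//.
  have -> : - x ^+ 2 / (1 *+ 2) = - (x ^+ 2 / 4) + - x ^+ 2 / (2 *+ 2) :> R by lra.
  rewrite expRD mulrA ler_wpM2r ?expR_ge0//.
  rewrite expRN ler_pdivrMr ?expR_gt0//.
  by have := expR_ge1Dx (x ^+ 2 / 4); lra.
rewrite ge0_integralZl//=.
- by rewrite integral_normal_pdf mule1 ltry.
- by apply/measurable_EFinP; exact: measurable_normal_pdf.
- by move=> x _; rewrite lee_fin normal_pdf_ge0.
Qed.

(** The density is everywhere positive, so its integral can vanish only over a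
    Lebesgue-null set. *)
Lemma normal_prob_itvy_gt0 (R : realType) (m s a : R) : s != 0 ->
  (0 < normal_prob m s `]a, +oo[)%E.
Proof.
move=> s0; rewrite lt_neqAle measure_ge0 andbT; apply/eqP => /esym.
rewrite /normal_prob => E0.
have : (\int[lebesgue_measure]_(x in `]a, +oo[) `|(normal_pdf m s x)%:E| = 0)%E.
  by under eq_integral do rewrite gee0_abs ?lee_fin ?normal_pdf_ge0//.
move/(ae_eq_integral_abs lebesgue_measure) => [//||N [mN N0 sN]].
  by apply/measurable_funTS/measurable_EFinP; exact: measurable_normal_pdf.
have aN : [set` `]a, +oo[] `<=` N.
  move=> x ax; apply: sN => /(_ ax) /= [] /eqP.
  by rewrite normal_pdfE// mulf_eq0 !gt_eqF ?normal_peak_gt0 ?expR_gt0.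
have := subset_measure0 _ mN aN N0.
move=> /(_ (measurable_itv _)) => E1.
by have := lebesgue_measure_itv `]a, +oo[; rewrite [LHS]E1 /= ltry.
Qed.

Lemma sqr_integral_law d (T : measurableType d) (R : realType)
    (P : probability T R) (X : {RV P >-> R})
    (mu : probability (measurableTypeR R) R) : has_law X mu ->
  (\int[P]_w (X w ^+ 2)%:E = \int[mu]_x (x ^+ 2)%:E)%E.
Proof.
apply: (@ge0_integral_law _ _ _ _ _ _ (fun x => (x ^+ 2)%:E)).
- by apply/measurable_EFinP; exact: measurable_funX.
- by move=> x; rewrite lee_fin sqr_ge0.
Qed.

Lemma Lfun2_law d (T : measurableType d) (R : realType) (P : probability T R)
    (X : {RV P >-> R}) (mu : probability (measurableTypeR R) R) :
  has_law X mu -> (\int[mu]_x (x ^+ 2)%:E < +oo)%E ->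
  (X : T -> R) \in Lfun P 2%:E.
Proof.
by move=> hX mu2; apply: Lfun2_sqr_lty; rewrite ?(sqr_integral_law hX).
Qed.

(** * Rescaling and non-degeneracy of the AMP estimate *)

Section state_equations.
Context d (T : measurableType d) (R : realType) (P : probability T R).
Variables beta Z : {RV P >-> R}.
Implicit Types tau theta t lambdas gamma : R.

Lemma measurable_eta_RV tau t : 0 <= t ->
  measurable_fun [set: T] (fun w => eta (beta w + tau * Z w) t).
Proof.
move=> t0; apply: (measurableT_comp (measurable_eta t0)).
by apply: measurable_funD => //; exact: measurable_funM.
Qed.

Lemma Lfun2_eta tau t : 0 <= t -> (beta : T -> R) \in Lfun P 2%:E ->
  (Z : T -> R) \in Lfun P 2%:E ->
  (fun w => eta (beta w + tau * Z w) t) \in Lfun P 2%:E.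
Proof.
move=> t0 b2 Z2; apply: (@Lfun2_dominated _ _ _ _ (fun w => beta w + tau * Z w)).
- exact: measurable_eta_RV.
- by move=> w; exact: norm_eta_le.
- by under eq_fun do rewrite addrC; exact: Lfun2_linear.
Qed.

Lemma prox_rescaled lambdas theta gamma w : 0 < lambdas -> 0 < theta ->
  prox (fun x : R => `|x|) (gamma * Z w + theta * beta w) lambdas =
  theta * eta (beta w + gamma / theta * Z w) (lambdas / theta).
Proof.
move=> l0 th0; rewrite prox_normr// -etaZ//; congr eta.
  by field; rewrite gt_eqF.
by rewrite mulrC divfK// gt_eqF.
Qed.

Lemma dprox_rescaled lambdas theta gamma w : 0 < lambdas -> 0 < theta ->
  dprox (fun x : R => `|x|) (gamma * Z w + theta * beta w) lambdas =
  deta (beta w + gamma / theta * Z w) (lambdas / theta).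
Proof.
move=> l0 th0; rewrite /dprox; under eq_fun do rewrite prox_normr//.
rewrite -[LHS]/(deta _ _) -[RHS](detaZ _ _ th0); congr deta.
  by field; rewrite gt_eqF.
by rewrite mulrC divfK// gt_eqF.
Qed.

(** The events |beta| <= n cover the probability space, so they cannot all be
    negligible. *)
Lemma bounded_with_positive_probability :
  exists M : R, (0 < P (beta @^-1` `[(- M)%R, M]))%E.
Proof.
apply/not_existsP => noM.
have PM (n : nat) : P.-negligible (beta @^-1` `[- n%:R, n%:R]).
  exists (beta @^-1` `[- n%:R, n%:R]); split => //.
    by rewrite -[X in measurable X]setTI; exact: measurable_funPT.
  apply/eqP; rewrite -measure_le0 leNgt; apply/negP; exact: noM.
have [N [mN PN sN]] := negligible_bigcup PM.
have TN : [set: T] `<=` N.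
  move=> w _; apply: sN; exists (Num.trunc `|beta w|).+1 => //=.
  by rewrite in_itv/= -ler_norml ltW// truncnS_gt.
have PT := subset_measure0 measurableT mN TN PN.
by have := probability_setT P; rewrite [LHS]PT => -[] /esym/eqP; rewrite oner_eq0.
Qed.

(** On the event that |beta| <= M and Z > K, with K large, the threshold is
    exceeded and eta(beta + tau Z; t) = beta + tau Z - t is above |a| |M|, hence
    above a beta. By independence this event has positive probability. *)
Lemma eta_not_proportional tau t a : 0 < tau -> 0 <= t ->
  has_law Z (normal_prob 0 1) -> independent_RV beta Z ->
  exists2 A : set T, measurable A & (0 < P A)%E /\
    forall w, A w -> eta (beta w + tau * Z w) t - a * beta w != 0.
Proof.
move=> tau0 t0 hZ hind; have [M PM] := bounded_with_positive_probability.
pose K := (M + t + `|a| * `|M|) / tau.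
exists (beta @^-1` `[- M, M] `&` Z @^-1` `]K, +oo[).
  by apply: measurableI; rewrite -[X in measurable X]setTI; exact: measurable_funPT.
split.
  rewrite hind// mule_gt0//.
  have -> : P (Z @^-1` `]K, +oo[) = normal_prob 0 1 `]K, +oo[ by exact: hZ.
  exact: normal_prob_itvy_gt0.
move=> w [/=]; rewrite !in_itv/= andbT => bM.
rewrite /K ltr_pdivrMr// mulrC => ZK.
have abM : a * beta w <= `|a| * `|M|.
  rewrite (le_trans (ler_norm _))// normrM ler_wpM2l// ler_norml.
  by have := ler_norm M; move: bM => /andP[]; lra.
have aM0 : 0 <= `|a| * `|M| by rewrite mulr_ge0.
have bM' : - M <= beta w by case/andP: bM.
by rewrite eta_gt ?gt_eqF//; lra.
Qed.

End state_equations.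

Section rescaled.
Context d (T : measurableType d) (R : realType) (P : probability T R).
Variables beta Z : {RV P >-> R}.
Hypotheses (beta2 : (beta : T -> R) \in Lfun P 2%:E)
  (Z2 : (Z : T -> R) \in Lfun P 2%:E).
Variables lambdas theta gamma : R.
Hypotheses (lambdas0 : 0 < lambdas) (theta0 : 0 < theta).

Let estimate w := eta (beta w + gamma / theta * Z w) (lambdas / theta).
Let proximal w :=
  prox (fun x : R => `|x|) (gamma * Z w + theta * beta w) lambdas.

Let estimate2 : estimate \in Lfun P 2%:E.
Proof. by apply: Lfun2_eta => //; rewrite divr_ge0 ?ltW. Qed.

Lemma Exp_sqr_prox :
  Exp P (fun w => proximal w ^+ 2) = theta ^+ 2 * Exp P (fun w => estimate w ^+ 2).
Proof.
rewrite -ExpZ; last exact: Lfun2_mul_Lfun1 estimate2 estimate2.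
by congr Exp; apply/funext => w; rewrite /proximal prox_rescaled//= exprMn mulrC.
Qed.

Lemma Exp_beta_prox :
  Exp P (fun w => beta w * proximal w) =
  theta * Exp P (fun w => beta w * estimate w).
Proof.
rewrite -ExpZ; last exact: Lfun2_mul_Lfun1 beta2 estimate2.
congr Exp; apply/funext => w.
by rewrite /proximal prox_rescaled//= [RHS]mulrC mulrCA.
Qed.

Lemma Exp_dprox :
  Exp P (fun w => dprox (fun x : R => `|x|) (gamma * Z w + theta * beta w) lambdas) =
  Exp P (fun w => deta (beta w + gamma / theta * Z w) (lambdas / theta)).
Proof. by congr Exp; apply/funext => w; rewrite dprox_rescaled. Qed.

End rescaled.

(** * Algebra of the state equations *)

Section algebra.
Variable R : realType.
Implicit Types alpha sigma tau theta lambda gamma kappa r s e : R.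

(** Multiplying the last equation by tau / sigma makes its terms match those of
    the previous one; subtracting leaves sigma / (lambda + 1) = 1 / tau, and the
    first equation is then linear in theta. *)
Lemma CGMT_sigma_tau2_theta kappa r e alpha sigma tau theta lambda :
  0 < sigma -> 0 < tau -> 0 <= lambda ->
  0 = - (alpha / (sigma * tau)) + theta - 1 + (alpha + lambda) / (lambda + 1) ->
  0 = - (1 / (2 * tau)) + r * kappa * alpha ^+ 2 / (2 * sigma ^+ 2 * tau)
      - tau * kappa / 2 * e + sigma / (lambda + 1) ->
  0 = sigma / (2 * tau ^+ 2) + r * kappa * alpha ^+ 2 / (2 * sigma * tau ^+ 2)
      - sigma * kappa / 2 * e ->
  sigma * tau = lambda + 1 /\ theta = (lambda + 1)^-1.
Proof.
move=> s0 t0 l0 e1 e2 e6.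
have l10 : lambda + 1 != 0 by rewrite gt_eqF// ltr_wpDl.
have sn : sigma != 0 by rewrite gt_eqF.
have tn : tau != 0 by rewrite gt_eqF.
have st : sigma * tau = lambda + 1.
  have e6' : 0 = 1 / (2 * tau) + r * kappa * alpha ^+ 2 / (2 * sigma ^+ 2 * tau)
      - tau * kappa / 2 * e.
    by rewrite -[LHS](mulr0 (tau / sigma)) [in LHS]e6; field; rewrite sn tn.
  have : sigma / (lambda + 1) = 1 / tau.
    have -> : 1 / tau = 1 / (2 * tau) + 1 / (2 * tau) by field.
    by lra.
  by move=> /eqP; rewrite eqr_div// mul1r => /eqP.
split=> //; move: e1; rewrite st => e1.
have : theta = 1 + (alpha - (alpha + lambda)) / (lambda + 1) by rewrite mulrBl; lra.
by move=> ->; field.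
Qed.

(** For r <> 0 the value a = e2 / r minimizes the quadratic form. For r = 0 the
    form is affine in a and everywhere positive, hence constant, so e2 = 0. *)
Lemma positive_form_solution (r e1 e2 : R) :
  (forall a : R, 0 < e1 - 2 * a * e2 + a ^+ 2 * r) ->
  exists2 alpha : R, r * alpha = e2 & r * alpha ^+ 2 < e1.
Proof.
move=> pos; have [r0|r0] := eqVneq r 0.
  have e20 : e2 = 0.
    apply/eqP/negP => /negP e20; have := pos (e1 / e2); have := pos 0.
    have -> : 2 * (e1 / e2) * e2 = 2 * e1 by field.
    by rewrite r0; lra.
  by exists 0; [rewrite mulr0 e20|have := pos 0; rewrite r0; lra].
exists (e2 / r); first by field.
have := pos (e2 / r).
have -> : 2 * (e2 / r) * e2 = 2 * (r * (e2 / r) ^+ 2) by field.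
by rewrite [_ ^+ 2 * r]mulrC; lra.
Qed.

(** In this lemma and the next, r and s are r_*^2 and sigma_*^2, while e1 and e2
    are the expectations of the square of the AMP estimate and of its product with
    beta. The proof isolates the reduced equations for gamma, alpha and sigma
    ([h3'], [h4'], [h6']), from which alpha and sigma cancel. *)
Lemma CGMT_to_AMP_algebra kappa r s e1 e2 alpha sigma tau lambda gamma :
  0 < sigma -> 0 < tau -> 0 <= lambda ->
  sigma * tau = lambda + 1 ->
  0 = gamma ^+ 2 - r * kappa - s
    + 2 * ((alpha + lambda) * r * kappa + lambda * s) / (lambda + 1)
    - ((alpha + lambda) ^+ 2 * r * kappa + sigma ^+ 2
       + lambda ^+ 2 * s) / (lambda + 1) ^+ 2 ->
  0 = r * kappa * alpha - sigma * tau * kappa * ((lambda + 1)^-1 * e2) ->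
  0 = sigma / (2 * tau ^+ 2) + r * kappa * alpha ^+ 2 / (2 * sigma * tau ^+ 2)
      - sigma * kappa / 2 * ((lambda + 1)^-1 ^+ 2 * e1) ->
  (gamma / (lambda + 1)^-1) ^+ 2 = s + kappa * (e1 - 2 * e2 + r).
Proof.
move=> s0 t0 l0 st h3 h4 h6.
have l1 : lambda + 1 != 0 by rewrite gt_eqF// ltr_wpDl.
have sn : sigma != 0 by rewrite gt_eqF.
have tn : tau != 0 by rewrite gt_eqF.
have h3' : (gamma / (lambda + 1)^-1) ^+ 2 =
    s + kappa * r * (1 - alpha) ^+ 2 + sigma ^+ 2.
  apply/eqP; rewrite -subr_eq0; apply/eqP.
  by rewrite -[RHS](mulr0 ((lambda + 1) ^+ 2)) [in RHS]h3; field.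
have h4' : kappa * e2 = r * kappa * alpha.
  have <- : (lambda + 1) * kappa * ((lambda + 1)^-1 * e2) = kappa * e2 by field.
  by apply/esym/eqP; rewrite -subr_eq0 -{1}st -h4.
have h6' : kappa * e1 = sigma ^+ 2 + r * kappa * alpha ^+ 2.
  apply/eqP; rewrite eq_sym -subr_eq0; apply/eqP.
  rewrite -[RHS](mulr0 (2 * sigma * tau ^+ 2)) [in RHS]h6 -st.
  by field; rewrite sn tn.
by rewrite h3'; lra.
Qed.

(** The choices of tau and lambda are forced by sigma tau = lambda + 1 and
    theta = 1 / (lambda + 1). *)
Lemma AMP_to_CGMT_algebra kappa r s e1 e2 alpha sigma theta gamma :
  0 < sigma -> 0 < theta ->
  r * alpha = e2 -> sigma ^+ 2 = kappa * (e1 - r * alpha ^+ 2) ->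
  gamma ^+ 2 = s + kappa * (e1 - 2 * e2 + r) ->
  let tau := (theta * sigma)^-1 in
  let lambda := theta^-1 - 1 in
  [/\ 0 = - (alpha / (sigma * tau)) + theta - 1 + (alpha + lambda) / (lambda + 1),
    0 = - (1 / (2 * tau)) + r * kappa * alpha ^+ 2 / (2 * sigma ^+ 2 * tau)
      - tau * kappa / 2 * (theta ^+ 2 * e1) + sigma / (lambda + 1),
    0 = (gamma * theta) ^+ 2 - r * kappa - s
    + 2 * ((alpha + lambda) * r * kappa + lambda * s) / (lambda + 1)
    - ((alpha + lambda) ^+ 2 * r * kappa + sigma ^+ 2
       + lambda ^+ 2 * s) / (lambda + 1) ^+ 2,
    0 = r * kappa * alpha - sigma * tau * kappa * (theta * e2) &
    0 = sigma / (2 * tau ^+ 2) + r * kappa * alpha ^+ 2 / (2 * sigma * tau ^+ 2)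
      - sigma * kappa / 2 * (theta ^+ 2 * e1)].
Proof.
move=> s0 th0 <- hs hg tau lambda.
have sn : sigma != 0 by rewrite gt_eqF.
have tn : theta != 0 by rewrite gt_eqF.
have ke1 : kappa * e1 = sigma ^+ 2 + kappa * r * alpha ^+ 2 by lra.
have l1 : lambda + 1 = theta^-1 by rewrite subrK.
have ke1E (c : R) :
    c * kappa / 2 * (theta ^+ 2 * e1) = c / 2 * theta ^+ 2 * (kappa * e1) by ring.
split.
- by rewrite l1 /tau /lambda; field; rewrite ?tn ?sn.
- by rewrite ke1E ke1 l1 /tau; field; rewrite ?tn ?sn.
- rewrite exprMn hg mulrDr [kappa * (e1 - _)]mulrBr ke1 l1 /lambda.
  by field; rewrite ?tn ?sn.
- by rewrite /tau; field; rewrite ?tn ?sn.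
- by rewrite ke1E ke1 /tau; field; rewrite ?tn ?sn.
Qed.

End algebra.

(** * Equivalence of the two systems *)

Theorem theorem2 (R : realType) (lambdas kappas sigmas2 rs2 : R)
    (hlambdas : 0 < lambdas) (hkappas : 0 < kappas) (hsigmas2 : 0 <= sigmas2)
    (Pi : probability (measurableTypeR R) R)
    (hrs2 : (\int[Pi]_b (b ^+ 2)%:E)%E = rs2%:E)
    (d : measure_display) (T : measurableType d) (P : probability T R)
    (beta Z : {RV P >-> R})
    (hbeta : has_law beta Pi)
    (hZ : has_law Z (normal_prob 0 1))
    (hind : independent_RV beta Z) :
  (forall alpha sigma tau2 theta lambda gamma2 : R,
     CGMT P beta Z lambdas kappas sigmas2 rs2
       alpha sigma tau2 theta lambda gamma2 ->
     AMP P beta Z lambdas kappas sigmas2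
       (gamma2 / theta) (lambdas / theta - lambdas)) /\
  (forall tau1 gamma1 : R,
     AMP P beta Z lambdas kappas sigmas2 tau1 gamma1 ->
     exists alpha sigma tau2 theta lambda gamma2 : R,
       [/\ CGMT P beta Z lambdas kappas sigmas2 rs2
             alpha sigma tau2 theta lambda gamma2,
           tau1 = gamma2 / theta &
           gamma1 = lambdas / theta - lambdas]).
Proof.
have b2 : (beta : T -> R) \in Lfun P 2%:E.
  by apply: (Lfun2_law hbeta); rewrite hrs2 ltry.
have Z2 : (Z : T -> R) \in Lfun P 2%:E.
  by apply: (Lfun2_law hZ); exact: normal_second_moment.
have Eb2 : Exp P (fun w => beta w ^+ 2) = rs2.
  by rewrite /Exp unlock (sqr_integral_law hbeta) hrs2.
have mse tau t a : 0 <= t ->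
    Exp P (fun w => (eta (beta w + tau * Z w) t - a * beta w) ^+ 2) =
    Exp P (fun w => eta (beta w + tau * Z w) t ^+ 2)
    - 2 * a * Exp P (fun w => beta w * eta (beta w + tau * Z w) t)
    + a ^+ 2 * rs2.
  by move=> t0; rewrite Exp_sqrB ?Eb2//; exact: Lfun2_eta.
have mse1 tau t : 0 <= t ->
    Exp P (fun w => (eta (beta w + tau * Z w) t - beta w) ^+ 2) =
    Exp P (fun w => eta (beta w + tau * Z w) t ^+ 2)
    - 2 * Exp P (fun w => beta w * eta (beta w + tau * Z w) t) + rs2.
  move=> /(mse tau t 1); rewrite mulr1 expr1n mul1r => <-.
  by under [in RHS]eq_fun do rewrite mul1r.
split.
  move=> alpha sigma tau theta lambda gamma [s0 t0 g0 l0 h1 h2 h3 h4 h5 h6].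
  have l1 : 0 < lambda + 1 by rewrite ltr_wpDl.
  have [st th] := CGMT_sigma_tau2_theta s0 t0 l0 h1 h2 h6.
  have th0 : 0 < theta by rewrite th invr_gt0.
  rewrite (Exp_sqr_prox b2 Z2)// th in h6; rewrite (Exp_beta_prox b2 Z2)// th in h4.
  rewrite Exp_dprox// th st in h5.
  have lt0 : 0 <= lambdas / theta by rewrite divr_ge0 ?ltW.
  rewrite th; split.
  - by rewrite divr_gt0 ?invr_gt0.
  - by rewrite addrC subrK divr_gt0 ?invr_gt0.
  - rewrite [lambdas + _]addrC subrK mse1 -?th// th.
    exact: (CGMT_to_AMP_algebra s0 t0 l0 st h3 h4 h6).
  - rewrite [lambdas + _]addrC subrK.
    have -> : lambdas / (lambda + 1)^-1 - lambdas = lambdas * lambda.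
      by rewrite invrK; ring.
    by rewrite [in LHS]h5 invrK; ring.
move=> tau gamma [t0 lg0 h1 h2].
set t := lambdas + gamma in lg0 h1 h2.
pose e1 := Exp P (fun w => eta (beta w + tau * Z w) t ^+ 2).
pose e2 := Exp P (fun w => beta w * eta (beta w + tau * Z w) t).
(* This is E[(s - a beta)^2] > 0 for the AMP estimate s. *)
have pos a : 0 < e1 - 2 * a * e2 + a ^+ 2 * rs2.
  rewrite -mse ?ltW//.
  have [A mA [PA Ane]] := eta_not_proportional a t0 (ltW lg0) hZ hind.
  apply: (Exp_sqr_gt0 _ mA PA Ane).
  under eq_fun do rewrite addrC -mulNr.
  by apply: Lfun2_linear => //; exact: Lfun2_eta (ltW lg0) b2 Z2.
have [alpha ra lt_e1] := positive_form_solution pos.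
pose sigma := Num.sqrt (kappas * (e1 - rs2 * alpha ^+ 2)).
have k0 : 0 < kappas * (e1 - rs2 * alpha ^+ 2) by rewrite mulr_gt0 ?subr_gt0.
have s0 : 0 < sigma by rewrite sqrtr_gt0.
have ss : sigma ^+ 2 = kappas * (e1 - rs2 * alpha ^+ 2) by rewrite sqr_sqrtr// ltW.
pose theta := lambdas / t.
have th0 : 0 < theta by rewrite divr_gt0.
have lt : lambdas / theta = t by rewrite /theta invf_div mulrC divfK ?gt_eqF.
have tt : tau * theta / theta = tau by rewrite mulfK// gt_eqF.
rewrite mse1 ?(ltW lg0)// -/e1 -/e2 in h1.
have [c1 c2 c3 c4 c6] := AMP_to_CGMT_algebra s0 th0 ra ss h1.
have l1 : theta^-1 - 1 = gamma / lambdas.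
  by rewrite /theta invf_div /t mulrDl divff ?gt_eqF//; ring.
(* Here tau_2 is determined by sigma tau_2 = lambda + 1 = 1 / theta. *)
exists alpha, sigma, (theta * sigma)^-1, theta, (theta^-1 - 1), (tau * theta).
split; [|by rewrite tt|by rewrite lt /t; ring].
split => //.
- by rewrite invr_gt0 mulr_gt0.
- by rewrite mulr_gt0.
- rewrite l1 divr_ge0 ?(ltW hlambdas)// h2 mulr_ge0//.
    by rewrite mulr_ge0 ?(ltW hkappas)// addrC ltW.
  by apply: Exp_ge0 => w; apply: deta_ge0; exact: ltW.
- by rewrite (Exp_sqr_prox b2 Z2)// tt lt.
- by rewrite (Exp_beta_prox b2 Z2)// tt lt.
- rewrite Exp_dprox// tt lt l1 [in LHS]h2.
  rewrite (_ : gamma + lambdas = t) ?(addrC gamma)// /theta.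
  by field; rewrite !gt_eqF.
- by rewrite (Exp_sqr_prox b2 Z2)// tt lt.
Qed.
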